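(* For each fixed $n \in \mathbb{N}$ ($n \ge 1$), the function $w \mapsto p_n(w)$, defined for positive integers $w$ as the number of flat LEGO structures built from $n$ tiles of size $w \times 1$, is a polynomial in $w$ of degree $n-1$ (that is, there is a polynomial of degree $n-1$ which takes the value $p_n(w)$ at every integer $w \ge 1$).
   Context: Flat LEGO structures. Fix integers $n \ge 1$ and $w \ge 1$. A $w\times 1$ tile at position $(x,y)\in\mathbb{Z}^2$ occupies the cells $x, x+1,\ldots,x+w-1$ of layer (row) $y$; all tiles are parallel (horizontal). A flat LEGO structure with $n$ tiles of size $w\times 1$ is a set of $n$ tiles at positions $(x_1,y_1),\ldots,(x_n,y_n)\in\mathbb{Z}^2$ such that no two tiles overlap (two distinct tiles on the same layer satisfy $|x_i-x_j|\ge w$), and such that the tiles are connected by interlocking: two tiles are joined (interlocked) if and only if they lie on adjacent layers, $|y_i-y_j|=1$, and share at least one column, $|x_i-x_j|<w$; the graph on the $n$ tiles whose edges are the joined pairs must be connected. Two tiles placed end-to-end on the same layer are not thereby joined. Structures are counted up to translation only (not up to rotation or reflection). The number of flat LEGO structures with $n$ tiles of size $w\times 1$ is denoted $p_n(w)$; for example $p_2(2)=3$, $p_3(2)=11$, $p_3(3)=31$, and $p_n(1)=1$ for all $n$. *)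

(* Defs.v *)
From HB Require Import structures.
From mathcomp Require Import all_boot all_order all_algebra finmap.
From mathcomp Require Import boolp classical_sets cardinality.
Set Implicit Arguments.
Unset Strict Implicit.
Unset Printing Implicit Defensive.
Import Order.TTheory GRing.Theory Num.Theory.
Local Open Scope fset_scope.
Local Open Scope ring_scope.

(* A w x 1 tile is given by its position (x, y): it occupies the cells
   x, ..., x + w - 1 of layer y. *)
Definition tile := (int * int)%type.

Definition joined (w : nat) (s t : tile) : bool :=
  (`|s.2 - t.2| == 1) && (`|s.1 - t.1| < w%:Z).

Definition no_overlap (w : nat) (S : {fset tile}) : Prop :=
  forall s t : tile, s \in S -> t \in S ->
    s != t -> s.2 = t.2 -> w%:Z <= `|s.1 - t.1|.

(* [connect] is taken in the finite type of the elements of S, so that paths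
   only visit tiles of S. Nonemptiness is left to the cardinality condition of
   [flat_lego]. *)
Definition interlocked (w : nat) (S : {fset tile}) : Prop :=
  forall s t : S, connect (fun u v : S => joined w (val u) (val v)) s t.

Definition flat_lego (n w : nat) (S : {fset tile}) : Prop :=
  [/\ #|` S| = n, no_overlap w S & interlocked w S].

Definition translate (v : int * int) (S : {fset tile}) : {fset tile} :=
  [fset (t.1 + v.1, t.2 + v.2) | t in S].

Definition translation_class (S : {fset tile}) : set {fset tile} :=
  [set T | exists v : int * int, T = translate v S]%classic.

Definition lego_classes (n w : nat) : set (set {fset tile}) :=
  [set translation_class S | S in [set S | flat_lego n w S]]%classic.

(* [fset_set] sends an infinite set to the empty one, so this is the intended
   number only together with [finite_set (lego_classes n w)]. *)
Definition lego_count (n w : nat) : nat := #|` fset_set (lego_classes n w)|.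

(* Main.v *)
Require Import Defs.
From mathcomp Require Import all_boot all_order all_algebra finmap.
From mathcomp Require Import boolp classical_sets cardinality.
From mathcomp Require Import zify ring.
Set Implicit Arguments.
Unset Strict Implicit.
Unset Printing Implicit Defensive.
Import Order.TTheory GRing.Theory Num.Theory.
Local Open Scope ring_scope.

(** Why the count is a polynomial.  Translate every structure so that its
    leftmost tile on the lowest layer is at the origin; the translation classes
    then correspond to these anchored structures.

    The geometry of an anchored structure of width w only depends on its columns
    through the comparisons |x - x'| < w.  Consider the set of residues modulo w
    that the columns of the tiles hit.  It contains 0; let k be its size.  There
    is exactly one increasing map f : Z -> Z with f (x + k) = f x + w and
    f 0 = 0 whose values are the integers with a residue in that set: number
    these integers consecutively, starting from 0.  Since x < x' + k holds iff
    f x < f x' + w, the map f preserves and reflects overlaps and joints.  Hence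
    applying f to the columns is a bijection from the anchored structures of
    width k that hit every residue modulo k onto the anchored structures of
    width w with the given residue set ([card_residues_eq]).

    So the number of structures with residue set {0} + R depends on the size j
    of R only.  With a_j the number of anchored structures of width j + 1 that
    hit every residue ([full_count]), and C(w - 1, j) choices of R among the
    nonzero residues,
      p_n(w) = sum_(j < n) a_j C(w - 1, j)   ([lego_count_binomial]),
    where the sum stops at n because n tiles hit at most n residues.  This is a
    polynomial in w of degree at most n - 1, valid from w = 1 on; its degree is
    n - 1 because a_(n-1) > 0, as the staircase of the n tiles (i, i) of width n
    shows ([full_count_gt0]). *)

(** * Spreading a set of residues *)

(** For [s] increasing in [0, w) with first entry 0, this numbers the integers
    whose residue modulo [w] is in [s]: the value at [x] is the [x]-th of them,
    counted from 0. *)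
Definition spread (w : nat) (s : seq nat) (x : int) : int :=
  w%:Z * (x %/ (size s)%:Z)%Z + (nth 0%N s `|(x %% (size s)%:Z)%Z|%N)%:Z.

Definition unspread (w : nat) (s : seq nat) (x : int) : int :=
  (size s)%:Z * (x %/ w%:Z)%Z + (index `|(x %% w%:Z)%Z|%N s)%:Z.

Section Spread.
Variables (w : nat) (s : seq nat).
Hypotheses (s_gt0 : (0 < size s)%N) (s_sorted : sorted ltn s).
Hypothesis s_lt : {in s, forall r, (r < w)%N}.

Let k := size s.
Let f := spread w s.

Lemma mod_size_lt x : (`|(x %% k%:Z)%Z| < k)%N.
Proof. by rewrite /k; lia. Qed.

Lemma spread_digit_lt x : (nth 0%N s `|(x %% k%:Z)%Z| < w)%N.
Proof. by apply/s_lt/mem_nth/mod_size_lt. Qed.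

Lemma spread_mod x : (f x %% w%:Z)%Z = (nth 0%N s `|(x %% k%:Z)%Z|%N)%:Z.
Proof.
rewrite /f /spread mulrC modzMDl modz_small //.
by have := spread_digit_lt x; rewrite /k; lia.
Qed.

Lemma spread_period x : f (x + k%:Z) = f x + w%:Z.
Proof.
have k0 : k%:Z != 0 by rewrite /k; lia.
rewrite /f /spread -/k (_ : x + k%:Z = 1 * k%:Z + x); last by ring.
by rewrite divzMDl // modzMDl mulrDr mulr1 -addrA addrC.
Qed.

(** Either [x] and [y] lie in the same period and the order of [s] decides, or
    [f x] and [f y] are in distinct blocks of length [w]. *)
Lemma spread_homo : {homo f : x y / x < y}.
Proof.
move=> x y lt_xy; have k0 : (0 < k)%N by [].
have := spread_digit_lt x; have := spread_digit_lt y.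
rewrite /f /spread -/k.
have [eq_q|ne_q] := eqVneq (x %/ k%:Z)%Z (y %/ k%:Z)%Z.
  rewrite eq_q ltrD2l ltz_nat => _ _.
  apply: (sorted_ltn_nth ltn_trans); rewrite ?inE ?mod_size_lt //.
  by have := divz_eq x k; have := divz_eq y k; rewrite eq_q; lia.
have lt_q : (x %/ k%:Z)%Z + 1 <= (y %/ k%:Z)%Z.
  suff : (x %/ k%:Z)%Z <= (y %/ k%:Z)%Z by lia.
  by apply: lez_pdiv2r; rewrite ?lez_nat // ltW.
by set a := nth _ _ _; set b := nth _ _ _; nia.
Qed.

Lemma spread_lt : {mono f : x y / x < y}.
Proof. exact: leW_mono (le_mono spread_homo). Qed.

Lemma spread_le : {mono f : x y / x <= y}.
Proof. exact: le_mono spread_homo. Qed.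

Lemma spread_inj : injective f.
Proof. exact: inc_inj spread_le. Qed.

(** This equivalence is what makes spreading compatible with both the overlap
    and the joint conditions: [x - y < k] reads [x < y + k], so it becomes
    [f x < f (y + k) = f y + w]. *)
Lemma spread_dist x y : (`|f x - f y| < w%:Z) = (`|x - y| < k%:Z).
Proof.
have := spread_lt x (y + k%:Z); have := spread_lt y (x + k%:Z).
by rewrite !spread_period; lia.
Qed.

Lemma unspreadK x : `|(x %% w%:Z)%Z|%N \in s -> f (unspread w s x) = x.
Proof.
move=> x_s; have w0 : (0 < w)%N by apply: leq_ltn_trans (s_lt x_s).
have idx : (index `|(x %% w%:Z)%Z|%N s < k)%N by rewrite index_mem.
have k0 : k%:Z != 0 by lia.
rewrite /f /spread /unspread -/k mulrC [k%:Z * _]mulrC divzMDl // modzMDl.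
have nth_i := nth_index 0%N x_s.
set i := index _ _ in idx nth_i *.
have i_small : 0 <= i%:Z < k%:Z by lia.
rewrite (divz_small (d := k%:Z) i_small) addr0 (modz_small i_small) absz_nat.
rewrite nth_i gez0_abs; last by rewrite modz_ge0 // eqz_nat -lt0n.
by rewrite -divz_eq.
Qed.

End Spread.

Lemma spread0 w s : spread w (0%N :: s) 0 = 0.
Proof. by rewrite /spread div0z mod0z mulr0. Qed.

(** * Moving a structure along a map of positions *)

(** Connectedness as an induction principle.  It mentions no path and no
    subtype of [S], hence transports directly along a map of tiles. *)
Lemma interlockedP w (S : {fset tile}) :
  interlocked w S <->
  (forall (P : pred tile) s, s \in S -> P s ->
     (forall u v, u \in S -> v \in S -> P u -> joined w u v -> P v) ->
     forall t, t \in S -> P t).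
Proof.
split=> [conn P s sS Ps step t tS|ind s t].
  have /connectP[p] := conn [` sS]%fset [` tS]%fset.
  move=> e_p last_p; rewrite -[t]/(val [` tS]%fset) last_p.
  have : P (val [` sS]%fset) by [].
  elim: p [` sS]%fset e_p {last_p} => //= v p IHp u /andP[e_uv e_p] Pu.
  by apply: IHp => //; apply: step e_uv => //; apply: valP.
pose e := fun u v : S => joined w (val u) (val v).
(* The induction predicate is reachability from [s], extended to all tiles. *)
pose P u := [exists v : S, (val v == u) && connect e s v].
suff /existsP[v /andP[/eqP/val_inj -> //]] : P (val t).
apply: (ind P (val s)) => //; try exact: valP.
  by apply/existsP; exists s; rewrite eqxx connect0.
move=> _ v _ vS /existsP[u /andP[/eqP <- e_su]] e_uv.
apply/existsP; exists [` vS]%fset; rewrite eqxx /=.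
by apply: connect_trans e_su _; apply: connect1.
Qed.

(** Translations, spreading and its inverse are all covered: only the
    distances between tiles, compared with the width, matter. *)
Lemma flat_lego_image n w w' (g : tile -> tile) (S : {fset tile}) :
  {in S &, injective g} ->
  {in S &, forall u v, (g u).2 - (g v).2 = u.2 - v.2} ->
  {in S &, forall u v,
    (`|(g u).1 - (g v).1| < w'%:Z) = (`|u.1 - v.1| < w%:Z)} ->
  flat_lego n w S -> flat_lego n w' (g @` S)%fset.
Proof.
move=> g_inj g_y g_x [card_S disj /interlockedP conn]; split.
- by rewrite card_in_imfset.
- move=> _ _ /imfsetP[/= s sS ->] /imfsetP[/= t tS ->] ne_g eq_y.
  rewrite leNgt g_x // -leNgt; apply: disj => //.
    by apply: contraNneq ne_g => ->.
  by have := g_y _ _ sS tS; rewrite eq_y; lia.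
- apply/interlockedP => P _ /imfsetP[/= s sS ->] Ps step _ /imfsetP[/= t tS ->].
  apply: (conn (P \o g) s) => // u v uS vS /= Pu e_uv.
  apply: (step (g u)) => //; try exact: in_imfset.
  by rewrite /joined g_y // g_x.
Qed.

Lemma translateD u v S : translate u (translate v S) = translate (u + v) S.
Proof.
rewrite /translate -imfset_comp; apply: eq_imfset => //= t /=.
by rewrite -!addrA ![u.1 + _]addrC ![u.2 + _]addrC.
Qed.

Lemma translate0 S : translate 0 S = S.
Proof.
apply/fsetP => t; apply/imfsetP/idP => [[/= u uS ->]|tS].
  by rewrite !addr0; case: u uS.
by exists t; rewrite //= !addr0; case: t tS.
Qed.

Lemma flat_lego_translate n w v S :
  flat_lego n w S -> flat_lego n w (translate v S).
Proof.
apply: flat_lego_image => [[a b] [c d] _ _ [] /addIr -> /addIr -> //| |].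
- by move=> s t _ _ /=; lia.
- by move=> s t _ _ /=; congr (_ < _); congr `|_|; lia.
Qed.

(** * Anchored structures *)

(** Comparison with the origin in the lexicographic order, layer first.  That
    order is invariant under translation, so moving its least tile to the origin
    normalizes a structure. *)
Definition origin_le (t : tile) : bool :=
  (0 < t.2) || ((t.2 == 0) && (0 <= t.1)).

Definition anchored (n w : nat) : set {fset tile} :=
  [set S | [/\ flat_lego n w S, (0, 0) \in S &
               {in S, forall t, origin_le t}]]%classic.

Lemma eq_translation_class S T :
  translation_class S = translation_class T -> exists v, T = translate v S.
Proof.
move=> eqST; suff : translation_class S T by [].
by rewrite eqST; exists 0; rewrite translate0.
Qed.

Lemma translation_class_translate v S :
  translation_class (translate v S) = translation_class S.
Proof.
apply/seteqP; split=> T /= [u ->].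
  by exists (u + v); rewrite translateD.
by exists (u - v); rewrite translateD subrK.
Qed.

Lemma mem_translate v S t : (t \in translate v S) = (t - v \in S).
Proof.
apply/imfsetP/idP => [[/= u uS ->]|tS].
  suff -> : (u.1 + v.1, u.2 + v.2) - v = u by [].
  by case: u v {uS} => a b [c d]; congr pair => /=; rewrite addrK.
by exists (t - v) => //; case: t v {tS} => a b [c d] /=; rewrite !subrK.
Qed.

(** If [T] is the translate of [S] by [v] and both are anchored, then [- v] is
    in [S] and [v] is in [T], so both are lexicographically nonnegative. *)
Lemma anchored_class_inj n w :
  {in anchored n w &, injective translation_class}.
Proof.
move=> S T; rewrite !inE => -[_ S0 S_ge] [_ T0 T_ge].
move=> /eq_translation_class[v eqT].
move: T0 T_ge; rewrite eqT => T0 T_ge.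
have := S_ge (0 - v); rewrite -mem_translate => /(_ T0).
have /T_ge : v \in translate v S by rewrite mem_translate subrr.
case: v {eqT T0 T_ge} => a b; rewrite /origin_le /= => ab_ge ab_le.
suff [-> ->] : a = 0 /\ b = 0 by rewrite translate0.
by split; lia.
Qed.

Lemma anchored_exists n w S :
  (0 < n)%N -> flat_lego n w S -> exists v, anchored n w (translate v S).
Proof.
move=> n_gt0 legoS; have [card_S _ _] := legoS.
have /fset0Pn[t0 t0S] : S != fset0 by rewrite -cardfs_gt0 card_S.
pose F (t : S) : (int *l int)%type := ((val t).2, (val t).1).
case: (@arg_minP _ _ _ [` t0S]%fset predT F isT) => m _ m_le.
exists (- val m); split.
- exact: flat_lego_translate.
- by rewrite mem_translate opprK add0r; exact: valP.
- move=> t; rewrite mem_translate opprK => tS.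
  have := m_le [` tS]%fset isT; rewrite leEprodlexi /=.
  by case: (val m) {tS} => a b; case: t => c d; rewrite /origin_le /=; lia.
Qed.

Lemma lego_classesE n w : (0 < n)%N ->
  lego_classes n w = [set translation_class S | S in anchored n w]%classic.
Proof.
move=> n_gt0; apply/seteqP; split=> _ [S legoS <-].
  have [v Sv] := anchored_exists n_gt0 legoS.
  by exists (translate v S) => //; rewrite translation_class_translate.
by exists S => //; case: legoS.
Qed.

(** One joint moves the column by less than [w] and the layer by one. *)
Lemma path_bounded w (S : {fset tile}) (s : S) (p : seq S) :
  path (fun u v : S => joined w (val u) (val v)) s p ->
  let t := last s p in
  (`|(val t).1 - (val s).1| <= (size p * w)%:Z) /\
  (`|(val t).2 - (val s).2| <= (size p)%:Z).
Proof.
elim: p s => [|u p IHp] s /=; first by rewrite !subrr.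
case/andP=> /andP[/eqP e_y e_x] /IHp /= [IHx IHy]; rewrite mulSn.
by split; lia.
Qed.

(** A repetition-free path from the origin has at most [n] steps, so anchored
    structures live in a fixed finite box. *)
Lemma finite_anchored n w : finite_set (anchored n w).
Proof.
pose B m := [fset (i%:Z - m%:Z) | i in iota 0 (m + m).+1]%fset.
pose box : {fset tile} := (B (n * w)%N `*` B n)%fset.
apply: (@sub_finite_set _ _ [set` fpowerset box]%classic);
  last exact: finite_fset.
move=> S [[card_S _ conn] S0 _] /=; rewrite fpowersetE.
apply/fsubsetP => t tS.
have inB m (x : int) : `|x| <= m%:Z -> x \in B m.
  move=> x_le; apply/imfsetP; exists (absz (x + m%:Z)); last by lia.
  by rewrite inE mem_iota; lia.
have /connectP[p /shortenP[q e_q uniq_q _] last_q] :=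
  conn [` S0]%fset [` tS]%fset.
have := path_bounded e_q; rewrite -last_q /= !subr0 => -[t_x t_y].
have size_q : (size q <= n)%N.
  move: uniq_q => /card_uniqP /= size_q.
  by rewrite ltnW // -size_q -card_S cardfE max_card.
rewrite in_fsetM !inB //; first by apply: le_trans t_y _; rewrite lez_nat.
by apply: le_trans t_x _; rewrite lez_nat leq_mul2r size_q orbT.
Qed.

(** * Counting by residues *)

(** Only the nonzero residues modulo [w.+1] are recorded, with index shifted by
    one: 0 is always hit by the tile at the origin. *)
Definition residues (w : nat) (S : {fset tile}) : {set 'I_w} :=
  [set i : 'I_w |
    has (fun t => (t.1 %% w.+1%:Z)%Z == (val i).+1%:Z) (enum_fset S)].

(** The residues encoded by [R], with 0 put back. *)
Definition marks (w : nat) (R : {set 'I_w}) : seq nat :=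
  0%N :: [seq (val i).+1 | i <- enum R].

Definition map_columns (f : int -> int) (S : {fset tile}) : {fset tile} :=
  [fset (f t.1, t.2) | t in S]%fset.

Lemma residuesP w S (i : 'I_w) :
  reflect (exists2 t, t \in S & (t.1 %% w.+1%:Z)%Z = i.+1%:Z)
          (i \in residues w S).
Proof.
rewrite inE; apply: (iffP hasP) => -[t tS] => [/eqP|] t_i; exists t => //.
exact/eqP.
Qed.

Lemma size_marks w (R : {set 'I_w}) : size (marks R) = #|R|.+1.
Proof. by rewrite /= size_map -cardE. Qed.

Lemma mem_marks w (R : {set 'I_w}) (i : 'I_w) : (i.+1 \in marks R) = (i \in R).
Proof.
rewrite inE /= (mem_map (f := fun i : 'I_w => i.+1)) ?mem_enum //.
by move=> a b [] /val_inj.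
Qed.

Lemma marks_ltn w (R : {set 'I_w}) : {in marks R, forall r, (r < w.+1)%N}.
Proof.
move=> r; rewrite inE => /orP[/eqP -> // | /mapP[i _ ->]].
by rewrite ltnS ltn_ord.
Qed.

Lemma marks_sorted w (R : {set 'I_w}) : sorted ltn (marks R).
Proof.
have sub : subseq [seq (val i).+1 | i <- enum R] (iota 1 w).
  rewrite (iotaDl 1 0) -val_enum_ord -map_comp; apply: map_subseq.
  by rewrite enumT; apply: filter_subseq.
apply: (subseq_sorted ltn_trans _ (iota_ltn_sorted 0 w.+1)).
exact: sub.
Qed.

Lemma fset_anchoredP n w S :
  reflect (anchored n w S) (S \in fset_set (anchored n w)).
Proof.
rewrite in_fset_set; last exact: finite_anchored.
by apply: (iffP idP); rewrite inE.
Qed.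

Section SpreadStructure.
Variables (w : nat) (s : seq nat).
Hypotheses (s_sorted : sorted ltn (0%N :: s)).
Hypothesis s_lt : {in 0%N :: s, forall r, (r < w)%N}.

Let f := spread w (0%N :: s).
Let h := unspread w (0%N :: s).
Let k := size (0%N :: s).

Lemma spread_ge0 x : (0 <= f x) = (0 <= x).
Proof. by rewrite -[0 in LHS](spread0 w s) spread_le. Qed.

Lemma anchored_spread n S : anchored n k S -> anchored n w (map_columns f S).
Proof.
case=> legoS S0 S_ge; split.
- apply: flat_lego_image legoS => [[a b] [c d] _ _ /= []|u v _ _ //|u v _ _ /=].
    by move=> /(@spread_inj w (0%N :: s)) -> // ->.
  by rewrite spread_dist.
- by apply/imfsetP; exists (0, 0) => //=; rewrite /f spread0.
- move=> _ /imfsetP[/= t tS ->]; rewrite /origin_le /= spread_ge0.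
  exact: S_ge.
Qed.

Lemma map_columns_spread_inj : injective (map_columns f).
Proof.
have inj : injective (fun t : tile => (f t.1, t.2)).
  by move=> [a b] [c d] /= [] /(@spread_inj w (0%N :: s)) -> // ->.
move=> S T eqST; apply/fsetP => t.
have := mem_imfset imfset_key (mem S) inj t.
have := mem_imfset imfset_key (mem T) inj t.
by move: eqST; rewrite /map_columns => -> -> /=.
Qed.

Lemma anchored_unspread n T :
  anchored n w T -> {in T, forall t, `|(t.1 %% w%:Z)%Z|%N \in 0%N :: s} ->
  exists2 S, anchored n k S & T = map_columns f S.
Proof.
move=> [legoT T0 T_ge] T_s.
have hK t : t \in T -> f (h t.1) = t.1 by move=> /T_s; exact: unspreadK.
exists (map_columns h T); last first.
  rewrite /map_columns -imfset_comp; apply/fsetP => t; apply/idP/imfsetP => /=.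
    by move=> tT; exists t => //=; rewrite hK //; case: t {tT}.
  by case=> u uT ->; rewrite hK //; case: u uT.
split.
- apply: flat_lego_image legoT => [[a b] [c d]|//|u v uT vT /=].
    move=> /hK /= ab /hK /= cd.
    by case=> eq_h ->; rewrite -ab eq_h cd.
  by rewrite -(@spread_dist w (0%N :: s)) // -/f !hK.
- by apply/imfsetP; exists (0, 0); rewrite //= /h /unspread div0z mod0z mulr0.
- move=> _ /imfsetP[/= t tT ->]; rewrite /origin_le /= -spread_ge0 hK //.
  exact: T_ge.
Qed.

End SpreadStructure.

(** Spreading sends the residue [j] modulo [#|R|.+1] to the [j]-th entry of
    [marks R], and these entries are distinct. *)
Lemma residues_spread w (R : {set 'I_w}) S :
  (residues w (map_columns (spread w.+1 (marks R)) S) == R) =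
  (residues #|R| S == [set: 'I_#|R|]).
Proof.
have resP (i : 'I_w) :
    reflect (exists2 t, t \in S &
               nth 0%N (marks R) `|(t.1 %% #|R|.+1%:Z)%Z| = i.+1)
            (i \in residues w (map_columns (spread w.+1 (marks R)) S)).
  apply: (iffP (residuesP _ _)) => [[_ /imfsetP[/= t tS ->]]|[t tS t_i]] /=.
    rewrite spread_mod ?size_marks ?marks_sorted //=; last exact: marks_ltn.
    by case=> t_i; exists t.
  exists (spread w.+1 (marks R) t.1, t.2); first by apply/imfsetP; exists t.
  rewrite spread_mod ?size_marks ?marks_sorted //=; last exact: marks_ltn.
  by rewrite t_i.
have modlt (t : tile) : (`|(t.1 %% #|R|.+1%:Z)%Z| < size (marks R))%N.
  by rewrite size_marks; lia.
apply/eqP/eqP => res.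
  apply/setP => j; rewrite finset.in_setT; apply/residuesP.
  have j_lt : (j.+1 < size (marks R))%N by rewrite size_marks ltnS.
  have nth_j : nth 0%N (marks R) j.+1 = (enum_val j).+1.
    by rewrite /= (nth_map (enum_val j)) -?cardE // -enum_val_nth.
  have : enum_val j \in residues w (map_columns (spread w.+1 (marks R)) S).
    by rewrite res enum_valP.
  case/resP => t tS; rewrite -nth_j => /eqP t_j; exists t => //; move: t_j.
  rewrite nth_uniq //; first by lia.
  exact: (sorted_uniq ltn_trans ltnn (marks_sorted R)).
apply/setP => i; apply/resP/idP => [[t tS t_i]|iR].
  by rewrite -mem_marks -t_i mem_nth.
have := iR; rewrite -mem_marks => i_s.
case def_j: (index i.+1 (marks R)) => [|j].
  by move: (nth_index 0%N i_s); rewrite def_j.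
have j_lt : (j < #|R|)%N by rewrite -ltnS -def_j -size_marks index_mem.
have : Ordinal j_lt \in residues #|R| S by rewrite res finset.in_setT.
case/residuesP => t tS /= t_j; exists t => //.
by rewrite t_j absz_nat -def_j nth_index.
Qed.

(** The coefficient a_j of the binomial expansion. *)
Definition full_count (n j : nat) : nat :=
  #|` [fset S in fset_set (anchored n j.+1) |
        residues j S == [set: 'I_j]]%fset|.

(** Spreading along [marks R] is the bijection; [unspread] provides the
    preimages. *)
Lemma card_residues_eq n w (R : {set 'I_w}) :
  #|` [fset S in fset_set (anchored n w.+1) | residues w S == R]%fset| =
  full_count n #|R|.
Proof.
have srt := marks_sorted R; have lt := @marks_ltn w R.
set full := [fset S in fset_set (anchored n #|R|.+1) |
              residues #|R| S == [set: 'I_#|R|]]%fset.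
transitivity #|` (map_columns (spread w.+1 (marks R)) @` full)%fset|;
  last first.
  by rewrite card_imfset //; exact: map_columns_spread_inj.
congr (#|` _|); apply/fsetP => T; rewrite !inE /=; apply/andP/imfsetP => /=.
  case=> /fset_anchoredP anT resT.
  have [|S anS defT] := anchored_unspread srt lt anT.
    move=> t tT; set r := absz _.
    have : (r < w.+1)%N by rewrite /r; lia.
    case def_r: r => [|r']; first by rewrite inE.
    rewrite ltnS => r'_lt; rewrite (mem_marks R (Ordinal r'_lt)) -(eqP resT).
    by apply/residuesP; exists t => //=; rewrite -def_r /r; lia.
  rewrite [size _]size_marks in anS; exists S => //.
  rewrite !inE /=; apply/andP; split; first exact/fset_anchoredP.
  by rewrite -residues_spread -defT.
case=> S; rewrite !inE /= => /andP[/fset_anchoredP anS resS] ->.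
split; last by rewrite residues_spread.
apply/fset_anchoredP.
by apply: anchored_spread => //; rewrite [size _]size_marks.
Qed.

(** Hitting all [j.+1] residues takes at least [j.+1] tiles. *)
Lemma full_count_eq0 n j : (n <= j)%N -> full_count n j = 0%N.
Proof.
move=> le_nj; apply/eqP; rewrite cardfs_eq0; apply/eqP/fsetP => S.
rewrite !inE /=; apply/negP => /andP[/fset_anchoredP anS /eqP res].
have [[card_S _ _] S0 _] := anS.
suff : (j.+1 <= n)%N by lia.
rewrite -card_S -(size_iota 0 j.+1).
rewrite -(size_map (fun t => `|(t.1 %% j.+1%:Z)%Z|%N)).
apply: uniq_leq_size; first exact: iota_uniq.
move=> [_|i]; first by apply/mapP; exists (0, 0).
rewrite mem_iota => /andP[_ i_lt]; apply/mapP.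
have : Ordinal (i_lt : (i < j)%N) \in residues j S.
  by rewrite res finset.in_setT.
by case/residuesP => t tS t_i; exists t => //; rewrite t_i.
Qed.

Definition staircase (n : nat) : {fset tile} :=
  [fset (i%:Z, i%:Z) | i in iota 0 n]%fset.

Lemma mem_staircase n i : ((i%:Z, i%:Z) \in staircase n) = (i < n)%N.
Proof. by rewrite mem_imfset /= ?mem_iota // => a b []. Qed.

Lemma flat_lego_staircase n : flat_lego n n (staircase n).
Proof.
have inS := mem_staircase n.
split.
- rewrite card_imfset /=; last by move=> a b [].
  by rewrite undup_id ?iota_uniq // size_iota.
- move=> _ _ /imfsetP[/= i _ ->] /imfsetP[/= j _ ->] /= ne_ij eq_ij.
  by rewrite eq_ij eqxx in ne_ij.
- apply/interlockedP => P _ /imfsetP[/= i + ->] Pi step _ /imfsetP[/= j + ->].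
  rewrite !mem_iota /= => i_lt j_lt.
  have P0 : P (0, 0).
    elim: i i_lt Pi => // i IHi i_lt Pi; apply: IHi; first by lia.
    by apply: step Pi _; rewrite ?inS /joined /=; lia.
  elim: j j_lt => // j IHj j_lt.
  by apply: (step (j%:Z, j%:Z)); rewrite ?inS ?IHj /joined /=; lia.
Qed.

(** The tiles of the staircase of width [m.+1] have pairwise distinct residues,
    so it is a structure with the largest possible residue set. *)
Lemma full_count_gt0 m : (0 < full_count m.+1 m)%N.
Proof.
rewrite cardfs_gt0; apply/fset0Pn; exists (staircase m.+1).
rewrite !inE /=; apply/andP; split.
  apply/fset_anchoredP; split; first exact: flat_lego_staircase.
    exact: (mem_staircase m.+1 0).
  by move=> _ /imfsetP[/= i _ ->]; rewrite /origin_le /=; lia.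
apply/eqP/setP => i; rewrite finset.in_setT; apply/residuesP.
exists (i.+1%:Z, i.+1%:Z); first by rewrite mem_staircase ltnS.
by rewrite modz_small //= ltz_nat ltnS ltn_ord.
Qed.

Lemma card_lego_classes n w : (0 < n)%N ->
  lego_count n w = #|` fset_set (anchored n w)|.
Proof.
move=> n_gt0; rewrite /lego_count lego_classesE // fset_set_image;
  last exact: finite_anchored.
rewrite card_in_imfset //= => S T /fset_anchoredP anS /fset_anchoredP anT.
exact: anchored_class_inj (mem_set anS) (mem_set anT).
Qed.

(** Sort the anchored structures by their residue set, then the residue sets by
    their cardinal. *)
Lemma lego_count_binomial n w : (0 < n)%N ->
  lego_count n w.+1 = (\sum_(j < n) full_count n j * 'C(w, j))%N.
Proof.
move=> n_gt0; rewrite card_lego_classes // card_fset_sum1.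
rewrite (partition_big (residues w) predT) //=.
transitivity (\sum_(R : {set 'I_w}) \sum_(j < n | #|R| == j) full_count n j)%N.
  apply: eq_bigr => R _; rewrite sum1_count.
  transitivity (full_count n #|R|).
    rewrite -card_residues_eq -size_filter.
    apply/perm_size/uniq_perm; rewrite ?filter_uniq ?fset_uniq // => S.
    by rewrite mem_filter !inE andbC.
  (* A residue set of size at least [n] contributes to neither side. *)
  have [lt_Rn|le_nR] := ltnP #|R| n.
    by rewrite (big_pred1 (Ordinal lt_Rn)).
  by rewrite full_count_eq0 // big1 // => j /eqP eq_R; have := ltn_ord j; lia.
rewrite (exchange_big_dep predT) //=; apply: eq_bigr => j _.
rewrite sum_nat_const mulnC -[w in RHS]card_ord -card_draws; congr (_ * _)%N.
by apply: eq_card => R; rewrite !inE.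
Qed.

(** * The polynomial *)

(** C(X - 1, j); the shift is there because the residue 0 is always hit, which
    leaves w - 1 residues to choose from. *)
Definition binomial_poly (j : nat) : {poly rat} :=
  (j`!%:R)^-1 *: \prod_(i < j) ('X - (i.+1%:R)%:P).

Lemma binomial_polyE j w : (binomial_poly j).[w.+1%:R] = 'C(w, j)%:R.
Proof.
have fact_neq0 : j`!%:R != 0 :> rat by rewrite pnatr_eq0 -lt0n fact_gt0.
rewrite hornerZ; apply: (mulfI fact_neq0).
rewrite mulVKf // -natrM mulnC bin_ffact.
elim: j {fact_neq0} => [|j IHj]; first by rewrite big_ord0 hornerC.
rewrite big_ord_recr /= hornerM IHj !hornerE ffactnSr natrM.
have [le_jw|lt_wj] := leqP j w; last by rewrite ffact_small // !mul0r.
by rewrite natrB // -!natr1; congr (_ * _); ring.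
Qed.

Lemma size_binomial_poly j : size (binomial_poly j) = j.+1.
Proof.
rewrite size_scale ?invr_eq0 ?pnatr_eq0 -?lt0n ?fact_gt0 //.
by rewrite size_prod_XsubC /index_enum -enumT size_enum_ord.
Qed.

Theorem theorem2 (n : nat) (hn : (0 < n)%N) :
  exists p : {poly rat},
    size p = n /\
    forall w : nat, (0 < w)%N ->
      finite_set (lego_classes n w) /\ (lego_count n w)%:R = p.[w%:R].
Proof.
exists (\sum_(j < n) (full_count n j)%:R *: binomial_poly j); split.
  case: n hn => // m _; rewrite big_ord_recr /= addrC.
  have size_top : size ((full_count m.+1 m)%:R *: binomial_poly m) = m.+1.
    by rewrite size_scale ?size_binomial_poly // pnatr_eq0 -lt0n full_count_gt0.
  rewrite size_polyDl size_top // ltnS; apply: (leq_trans (size_sum _ _ _)).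
  apply/bigmax_leqP => j _; apply: (leq_trans (size_scale_leq _ _)).
  by rewrite size_binomial_poly.
case=> // w _; split.
  by rewrite lego_classesE //; apply/finite_image/finite_anchored.
rewrite lego_count_binomial // natr_sum horner_sum; apply: eq_bigr => j _.
by rewrite natrM hornerZ binomial_polyE.
Qed.
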